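(* Let $S=(X,P)$ be a stochastic approximation space, let $T:X\to P^*(X)$ be a set-valued mapping, and let $U$ be a random variable on $X$ with finitely many values $u_1,\dots,u_n$. Then $$\underline{V}(U)=\underline{E}(U^2)-(2-c)\,(\underline{E}(U))^2,\qquad\text{where } c=\sum_{k=1}^n \underline{P}(U=u_k).$$
   Context: $P^*(X)$ denotes the set of all non-empty subsets of a non-empty set $X$. A stochastic approximation space is a pair $S=(X,P)$ where $X$ is a non-empty set and $P$ is a probability measure on $X$. For a set-valued mapping $T:X\to P^*(X)$ and $A\subseteq X$, the lower inverse of $A$ is $T^+(A)=\{x\in X : T(x)\subseteq A\}$. It is understood that $T^+(A)$ is an event whenever $A$ is. The lower probability of an event $A$ is $\underline{P}(A)=P(T^+(A))$. A random variable $U$ is a real-valued random variable on $X$ taking finitely many distinct values $u_1,\dots,u_n$, and $\underline{P}(U=u_k)=\underline{P}(\{x\in X: U(x)=u_k\})$. The lower expectation of $U$ is $\underline{E}(U)=\sum_{k=1}^n u_k\,\underline{P}(U=u_k)$, and for a function $g:\mathbb{R}\to\mathbb{R}$ the lower expectation of $g(U)$ is understood as $\underline{E}(g(U))=\sum_{k=1}^n g(u_k)\,\underline{P}(U=u_k)$. The lower variance of $U$ is $\underline{V}(U)=\underline{E}\big((U-\underline{E}(U))^2\big)$. *)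

(* Defs.v *)
From HB Require Import structures.
From mathcomp Require Import all_boot all_order all_algebra.
From mathcomp Require Import all_classical all_reals all_analysis.
Set Implicit Arguments.
Unset Strict Implicit.
Unset Printing Implicit Defensive.
Import Order.TTheory GRing.Theory Num.Theory.
Local Open Scope classical_set_scope.
Local Open Scope ring_scope.

Definition lower_inverse (X : Type) (T : X -> set X) (A : set X) : set X :=
  [set x | T x `<=` A].

Section LowerOperators.
Context {d : measure_display} {X : measurableType d} {R : realType}.
Variables (P : probability X R) (T : X -> set X).

(* [fine] loses nothing: a probability measure takes its values in [0, 1]. *)
Definition lower_prob (A : set X) : R := fine (P (lower_inverse T A)).

(* The sums below range over the distinct values of U; they are meant for U
   with finite range (a finitely supported sum over an infinite support is 0
   in the library). *)
Definition lower_expectation (U : X -> R) : R :=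
  \sum_(r \in range U) r * lower_prob [set x | U x = r].

(* The lower expectation of g(U) sums over the values of U, not over those of
   the composite g \o U: lower probabilities are not additive, so when g
   identifies two values of U this is in general different from
   [lower_expectation (g \o U)]. *)
Definition lower_expectation_of (g : R -> R) (U : X -> R) : R :=
  \sum_(r \in range U) g r * lower_prob [set x | U x = r].

Definition lower_variance (U : X -> R) : R :=
  lower_expectation_of (fun r => (r - lower_expectation U) ^+ 2) U.

End LowerOperators.

(* Main.v *)
Require Import Defs.
From mathcomp Require Import all_boot all_order all_algebra.
From mathcomp Require Import all_classical all_reals all_analysis.
From mathcomp Require Import ring.
Import Order.TTheory GRing.Theory Num.Theory.
Local Open Scope classical_set_scope.
Local Open Scope ring_scope.

(** With weights [p k], the lower probabilities of the events [U = u k], and [m] the weighted sum of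
    the [u k], the result is the expansion of the square under the sum ([sum_sqrrB_weighted]). Lower
    probabilities are not additive, so the weights need not sum to 1: their total [c] stays as the
    coefficient of [m ^+ 2], where the classical formula has 1. *)

Lemma fsbig_range (I : finType) (J : choiceType) (V : nmodType) (u : I -> J)
    (F : J -> V) :
  injective u -> \sum_(r \in range u) F r = \sum_i F (u i).
Proof.
move=> u_inj; rewrite fsbig_image; last by move=> i j _ _; exact: u_inj.
rewrite [RHS]fsbig_seq ?index_enum_uniq//.
(* Both index sets are all of [I], since its enumeration contains every element. *)
by apply: eq_fsbigl; apply/seteqP; split=> i _ //=; rewrite mem_index_enum.
Qed.

Lemma sum_sqrrB_weighted (R : comPzRingType) (I : finType) (u p : I -> R) (m : R) :
  \sum_i (u i - m) ^+ 2 * p i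
  = \sum_i u i ^+ 2 * p i - 2 * m * (\sum_i u i * p i) + m ^+ 2 * \sum_i p i.
Proof.
rewrite !mulr_sumr -sumrB -big_split /=.
by apply: eq_bigr => i _; ring.
Qed.

Theorem theorem2p19 (d : measure_display) (X : measurableType d) (R : realType)
    (P : probability X R) (T : X -> set X)
    (T_nonempty : forall x : X, T x !=set0)
    (T_measurable : forall A : set X,
       measurable A -> measurable (lower_inverse T A))
    (U : {RV P >-> R}) (n : nat) (u : 'I_n -> R)
    (u_distinct : injective u) (u_values : range U = range u) :
  let c := \sum_(k < n) lower_prob P T [set x | U x = u k] in
  lower_variance P T U
  = lower_expectation_of P T (fun r : R => r ^+ 2) U
    - (2 - c) * (lower_expectation P T U) ^+ 2.
Proof.
rewrite /lower_variance /lower_expectation_of /lower_expectation u_values.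
rewrite !fsbig_range//.
(* Here [m] is itself the sum in the cross term, so that term is [- 2 * m ^+ 2] and combines with
   [c * m ^+ 2]. *)
by rewrite sum_sqrrB_weighted; ring.
Qed.
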